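(* Let $\Sigma$ be a finite alphabet and let $f, g : \Sigma^* \to [0,1]$ be functions computed by affine finite automata over $\Sigma$. Then there exists an affine finite automaton $\mathcal{C}$ over $\Sigma$ such that $f_{\mathcal{C}}(w) = f(w)\, g(w)$ for all $w \in \Sigma^*$.
   Context: A real vector is affine if its coordinates sum to $1$; a real square matrix is affine if each of its columns is an affine vector. An affine finite automaton (AfA) over a finite alphabet $\Sigma$ is a tuple $A = (E, \Sigma, \{M_x\}_{x\in\Sigma}, \vec{v}_0, E_a)$, where $E=\{e_1,\dots,e_k\}$ is a finite set of states, each $M_x$ is a $k\times k$ real affine matrix, $\vec{v}_0\in\mathbb{R}^k$ is an affine vector (the initial state), and $E_a\subseteq E$ is the set of accepting states. For $w = w_1\cdots w_n\in\Sigma^*$ put $M_w = M_{w_n}\cdots M_{w_1}$ (the identity if $w$ is the empty word) and $\vec{v}_f = M_w\vec{v}_0$. The function $f_A:\Sigma^*\to[0,1]$ computed by $A$ is $$f_A(w) = \frac{\sum_{e_i\in E_a} |(\vec{v}_f)_i|}{\sum_{e_i\in E} |(\vec{v}_f)_i|}.$$ *)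

(* Defs.v *)
From HB Require Import structures.
From mathcomp Require Import all_boot all_order all_algebra.
From mathcomp Require Import reals.

Set Implicit Arguments.
Unset Strict Implicit.
Unset Printing Implicit Defensive.

Import Order.TTheory GRing.Theory Num.Theory.

Local Open Scope ring_scope.

Definition affine_vec (R : realType) (k : nat) (v : 'cV[R]_k) : Prop :=
  \sum_(i < k) v i 0 = 1.

Definition affine_mx (R : realType) (k : nat) (M : 'M[R]_k) : Prop :=
  forall j : 'I_k, affine_vec (col j M).

(* The states e_1, ..., e_k are the elements of 'I_k.  There is no need to
   require k > 0: the initial vector cannot be affine when k = 0. *)
Record afa (R : realType) (Sigma : finType) : Type := Afa {
  afa_size : nat;
  afa_trans : Sigma -> 'M[R]_afa_size;
  afa_init : 'cV[R]_afa_size;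
  afa_acc : {set 'I_afa_size};
  afa_trans_affine : forall x : Sigma, affine_mx (afa_trans x);
  afa_init_affine : affine_vec afa_init
}.

(* M_(w_1 ... w_n) = M_(w_n) *m ... *m M_(w_1): the first letter acts first. *)
Fixpoint afa_word_mx (R : realType) (Sigma : finType) (A : afa R Sigma)
    (w : seq Sigma) : 'M[R]_(afa_size A) :=
  match w with
  | [::] => 1%:M
  | x :: w' => afa_word_mx A w' *m afa_trans A x
  end.

Definition afa_final (R : realType) (Sigma : finType) (A : afa R Sigma)
    (w : seq Sigma) : 'cV[R]_(afa_size A) :=
  afa_word_mx A w *m afa_init A.

Definition afa_fun (R : realType) (Sigma : finType) (A : afa R Sigma)
    (w : seq Sigma) : R :=
  (\sum_(i in afa_acc A) `|afa_final A w i 0|)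
    / (\sum_(i < afa_size A) `|afa_final A w i 0|).

Definition afa_computes (R : realType) (Sigma : finType) (A : afa R Sigma)
    (f : seq Sigma -> R) : Prop :=
  forall w : seq Sigma, f w = afa_fun A w.

(* The facts below show that the quotient in afa_fun is never a division by
   zero and that afa_fun takes its values in [0, 1]. *)

Lemma affine_mulmx (R : realType) (k : nat) (M : 'M[R]_k) (v : 'cV[R]_k) :
  affine_mx M -> affine_vec v -> affine_vec (M *m v).
Proof.
move=> hM hv; rewrite /affine_vec.
under eq_bigr => i _ do rewrite mxE.
rewrite exchange_big /= -[RHS]hv; apply: eq_bigr => j _.
rewrite -mulr_suml -[RHS]mul1r; congr (_ * _).
by rewrite -(hM j); apply: eq_bigr => i _; rewrite mxE.
Qed.

Lemma afa_final_affine (R : realType) (Sigma : finType) (A : afa R Sigma)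
    (w : seq Sigma) : affine_vec (afa_final A w).
Proof.
rewrite /afa_final; move: (afa_init A) (afa_init_affine A).
elim: w => [|x w IHw] v hv /=; first by rewrite mul1mx.
by rewrite -mulmxA; apply/IHw/affine_mulmx => //; apply: afa_trans_affine.
Qed.

Lemma afa_denominator_gt0 (R : realType) (Sigma : finType) (A : afa R Sigma)
    (w : seq Sigma) : 0 < \sum_(i < afa_size A) `|afa_final A w i 0|.
Proof.
apply: lt_le_trans (ler_norm_sum _ _ _).
by rewrite (afa_final_affine A w) normr1.
Qed.

Lemma afa_fun_bounds (R : realType) (Sigma : finType) (A : afa R Sigma)
    (w : seq Sigma) : 0 <= afa_fun A w <= 1.
Proof.
rewrite /afa_fun ler_pdivrMr ?afa_denominator_gt0 // mul1r.
rewrite divr_ge0 ?sumr_ge0 //=.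
rewrite [leRHS](bigID (mem (afa_acc A))) /=.
by rewrite lerDl sumr_ge0.
Qed.

(* Main.v *)
Require Import Defs.
From mathcomp Require Import all_boot all_order all_algebra.
From mathcomp Require Import reals.
From mathcomp Require Import mxtens.

Set Implicit Arguments.
Unset Strict Implicit.
Unset Printing Implicit Defensive.

Import Order.TTheory GRing.Theory Num.Theory.

Local Open Scope ring_scope.

(* The product automaton runs both automata on the tensor product of their
   state spaces.  By the mixed product rule its final vector is the tensor
   product of the two final vectors, and the l1-norm restricted to a rectangle
   of indices is multiplicative on tensors, so the numerators and the
   denominators of the two quotients multiply separately. *)

(** Since [mxtens_unindex] is a bijection onto pairs of indices, reindexing along it turns the
    expanded double sum into a single one. *)
Lemma big_mxtens (S : pzRingType) (m n : nat) (P : pred 'I_m) (Q : pred 'I_n)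
    (F : 'I_m -> S) (G : 'I_n -> S) :
  \sum_(k < m * n | P (mxtens_unindex k).1 && Q (mxtens_unindex k).2)
     F (mxtens_unindex k).1 * G (mxtens_unindex k).2
  = (\sum_(i | P i) F i) * (\sum_(j | Q j) G j).
Proof.
rewrite big_distrlr pair_big /= (reindex (@mxtens_unindex m n)) //=.
by exists (@mxtens_index m n) => k _; rewrite (mxtens_indexK, mxtens_unindexK).
Qed.

(* The columns of [u *t v] are indexed by ['I_(1 * 1)], convertible to ['I_1]. *)
Lemma tens_cVE (S : pzRingType) (m n : nat) (u : 'cV[S]_m) (v : 'cV[S]_n)
    (k : 'I_(m * n)) (j : 'I_1) :
  (u *t v) k j = u (mxtens_unindex k).1 0 * v (mxtens_unindex k).2 0.
Proof. by rewrite mxE; congr (u _ _ * v _ _); apply: ord1. Qed.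

Section ProductAutomaton.

Variables (R : realType) (Sigma : finType).

Lemma affine_vec_tens (m n : nat) (u : 'cV[R]_m) (v : 'cV[R]_n) :
  affine_vec u -> affine_vec v -> @affine_vec R (m * n) (u *t v).
Proof.
move=> hu hv; rewrite /affine_vec.
under eq_bigr => k _ do rewrite tens_cVE.
by rewrite (big_mxtens xpredT xpredT (u^~ 0) (v^~ 0)) hu hv mulr1.
Qed.

(** Each column of [M *t N] is the tensor product of a column of [M] and a column of [N]. *)
Lemma affine_mx_tens (m n : nat) (M : 'M[R]_m) (N : 'M[R]_n) :
  affine_mx M -> affine_mx N -> affine_mx (M *t N).
Proof.
move=> hM hN k.
rewrite /affine_vec.
rewrite -(affine_vec_tens (hM (mxtens_unindex k).1) (hN (mxtens_unindex k).2)).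
by apply: eq_bigr => i _; rewrite tens_cVE !mxE.
Qed.

Lemma sum_normr_tens (m n : nat) (P : pred 'I_m) (Q : pred 'I_n)
    (u : 'cV[R]_m) (v : 'cV[R]_n) (j : 'I_1) :
  \sum_(k < m * n | P (mxtens_unindex k).1 && Q (mxtens_unindex k).2)
     `|(u *t v) k j|
  = (\sum_(i | P i) `|u i 0|) * (\sum_(i | Q i) `|v i 0|).
Proof.
rewrite -big_mxtens.
by apply: eq_bigr => k _; rewrite tens_cVE normrM.
Qed.

Definition afa_prod (A B : afa R Sigma) : afa R Sigma :=
  @Afa R Sigma (afa_size A * afa_size B)
    (fun x => afa_trans A x *t afa_trans B x)
    (afa_init A *t afa_init B)
    [set k | ((mxtens_unindex k).1 \in afa_acc A)
             && ((mxtens_unindex k).2 \in afa_acc B)]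
    (fun x => affine_mx_tens (@afa_trans_affine _ _ A x)
                             (@afa_trans_affine _ _ B x))
    (affine_vec_tens (@afa_init_affine _ _ A) (@afa_init_affine _ _ B)).

Lemma afa_word_mx_prod (A B : afa R Sigma) (w : seq Sigma) :
  afa_word_mx (afa_prod A B) w = afa_word_mx A w *t afa_word_mx B w.
Proof.
elim: w => [|x w IHw] /=; last by rewrite IHw tensmx_mul.
(* Empty word: the identity is the tensor of two identities, because two indices agree iff both
   components of their decodings agree. *)
apply/matrixP => k l; rewrite !mxE -natrM mulnb.
by rewrite -(can_eq (@mxtens_unindexK _ _)).
Qed.

Lemma afa_final_prod (A B : afa R Sigma) (w : seq Sigma) :
  afa_final (afa_prod A B) w = afa_final A w *t afa_final B w.
Proof. by rewrite /afa_final afa_word_mx_prod -tensmx_mul. Qed.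

Lemma afa_fun_prod (A B : afa R Sigma) (w : seq Sigma) :
  afa_fun (afa_prod A B) w = afa_fun A w * afa_fun B w.
Proof.
rewrite /afa_fun afa_final_prod mulrACA -invfM.
(* Both index sets are rectangles: all pairs of states for the denominator, pairs of accepting
   states for the numerator. *)
rewrite -(sum_normr_tens xpredT xpredT _ _ 0).
rewrite -(sum_normr_tens (mem (afa_acc A)) (mem (afa_acc B)) _ _ 0).
by congr (_ / _); apply: eq_bigl => k; rewrite inE.
Qed.

End ProductAutomaton.

Theorem proposition4 (R : realType) (Sigma : finType) (f g : seq Sigma -> R)
    (hf : exists A : afa R Sigma, afa_computes A f)
    (hg : exists B : afa R Sigma, afa_computes B g) :
  exists C : afa R Sigma, forall w : seq Sigma, afa_fun C w = f w * g w.
Proof.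
case: hf hg => [A hA] [B hB]; exists (afa_prod A B) => w.
by rewrite afa_fun_prod hA hB.
Qed.
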